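(* Let $U$ be an infinite set with $|U| = \kappa$, $\aleph_0 \leq \kappa$. Then for every $S \subseteq U$ such that $|S| < |U|$ there exists an injective function $\star_S : U^2 \to U$ such that for every sequence $s \in \mathsf{Sec}$, $\left|\mathit{fix}_s(\star_S)\right| = |S|$.
   Context: Sequences: $\mathsf{Sec}$ is the smallest set of terms generated by the grammar $\mathsf{sec} ::= \mathtt{elem}\ * \mid \mathtt{cons}\ *\ \mathsf{sec}$, where $* \in \{\pi, \rho\}$ (nonempty finite sequences of the two symbols $\pi,\rho$). For $\star : U^2 \to U$ and binary relations $r, s$ on $U$, put $r \mathbin{\underline{\nabla}} s = \{\langle a, x \star y\rangle \mid \langle a,x\rangle \in r,\ \langle a,y\rangle \in s\}$. Let $\mathit{Id}$ be the identity relation on $U$ and $E = U \times U$; let $\breve{r}$ denote the converse of $r$ and $\circ$ relational composition, $x\circ y=\{\langle a,b\rangle\mid \exists c\,(\langle a,c\rangle\in x\wedge\langle c,b\rangle\in y)\}$. Define $\underline{\pi}$ as the converse of $\mathit{Id} \mathbin{\underline{\nabla}} E$ (so $\underline{\pi} = \{\langle u \star v, u\rangle \mid u,v \in U\}$) and $\underline{\rho}$ as the converse of $E \mathbin{\underline{\nabla}} \mathit{Id}$ (so $\underline{\rho} = \{\langle u \star v, v\rangle \mid u,v \in U\}$). For $s \in \mathsf{Sec}$ define the relation $\underline{s}$ by $\underline{\mathtt{elem}\ *} = \underline{*}$ and $\underline{\mathtt{cons}\ *\ s} = \underline{*} \circ \underline{s}$. The $s$-controlled fixpoints of $\star$ are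 $\mathit{fix}_s(\star) = \{u \in U \mid \langle u,u\rangle \in \underline{s}\}$. *)

(* Defs.v *)
From mathcomp Require Import all_boot.
From mathcomp Require Import boolp classical_sets functions cardinality.

Set Implicit Arguments.
Unset Strict Implicit.
Unset Printing Implicit Defensive.

Local Open Scope classical_set_scope.
Local Open Scope card_scope.

Definition card_lt (T U : Type) (A : set T) (B : set U) : Prop :=
  A #<= B /\ A #!= B.

Inductive proj_sym : Type := Pi | Rho.

Inductive Sec : Type :=
  | Elem of proj_sym
  | Cons of proj_sym & Sec.

Definition nabla (U : Type) (star : U * U -> U) (r s : set (U * U)) :
    set (U * U) :=
  [set p | exists x y : U,
     [/\ r (p.1, x), s (p.1, y) & p.2 = star (x, y)]].

Definition rel_pi (U : Type) (star : U * U -> U) : set (U * U) :=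
  ((nabla star diagonal ([set: U] `*` [set: U]))^-1)%relation.

Definition rel_rho (U : Type) (star : U * U -> U) : set (U * U) :=
  ((nabla star ([set: U] `*` [set: U]) diagonal)^-1)%relation.

Definition rel_sym (U : Type) (star : U * U -> U) (c : proj_sym) :
    set (U * U) :=
  match c with Pi => rel_pi star | Rho => rel_rho star end.

(* [\;] composes in diagrammatic order: (a, b) is in [r \; s] iff for some c,
   (a, c) is in [r] and (c, b) is in [s]. *)
Fixpoint rel_sec (U : Type) (star : U * U -> U) (s : Sec) : set (U * U) :=
  match s with
  | Elem c => rel_sym star c
  | Cons c s' => (rel_sym star c \; rel_sec star s')%relation
  end.

Definition fix_sec (U : Type) (star : U * U -> U) (s : Sec) : set U :=
  [set u | rel_sec star s (u, u)].

Lemma rel_piE (U : Type) (star : U * U -> U) :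
  rel_pi star = [set p | exists u v, p = (star (u, v), u)].
Proof.
apply/seteqP; split=> -[a b] /=.
  by move=> [x [y [/= bx _ ->]]]; exists x, y; rewrite /diagonal /= in bx; rewrite bx.
by move=> [u [v [-> ->]]]; exists u, v.
Qed.

Lemma rel_rhoE (U : Type) (star : U * U -> U) :
  rel_rho star = [set p | exists u v, p = (star (u, v), v)].
Proof.
apply/seteqP; split=> -[a b] /=.
  by move=> [x [y [/= _ bx ->]]]; exists x, y; rewrite /diagonal /= in bx; rewrite bx.
by move=> [u [v [-> ->]]]; exists u, v.
Qed.

(* Main.v *)
(* Let every point of S satisfy u * u = u, and send all other pairs injectively
   into the complement of S so that a rank in nat strictly increases: the rank
   of x * y exceeds the ranks of x and y.  Following projections from u then
   either stays at u (if u is in S) or strictly decreases the rank at the first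
   step and never increases it again, so that fix_s = S for every s.  Such a
   star exists because nat * (U * U) injects into the complement of S, which is
   Hessenberg's theorem k * k = k for infinite cardinals, obtained here from
   Zorn's lemma. *)
Require Import Defs.
From mathcomp Require Import all_boot.
From mathcomp Require Import boolp classical_sets functions cardinality.

Local Open Scope classical_set_scope.
Local Open Scope card_scope.

(** Zorn's lemma gives a maximal graph of a partial injection from [A] to [B]. If it misses both
    some [a] in [A] and some [b] in [B], adding [(a, b)] enlarges it; so it covers [A] or [B]. *)
Lemma card_le_total {T U : pointedType} (A : set T) (B : set U) :
  A #<= B \/ B #<= A.
Proof.
(* The equivalence states functionality and injectivity at once. *)
pose P : set (set (T * U)) := [set G | G `<=` A `*` B /\
  forall p q, G p -> G q -> (p.1 = q.1 <-> p.2 = q.2)].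
have [|G [[GAB Ginj] Gmax]] := @Zorn_bigcup _ P.
  move=> F FP Ftot; split=> [p [G FG Gp]|p q [G FG Gp] [H FH Hq]].
    by have [+ _] := FP _ FG; exact.
  have [_ Ginj] := FP _ FG; have [_ Hinj] := FP _ FH.
  have [GH|HG] := Ftot _ _ FG FH.
    by apply: Hinj => //; exact: GH.
  by apply: Ginj => //; exact: HG.
have [GA|/existsNP[a]] := pselect (forall a, A a -> exists b, G (a, b)).
  left; apply/pcard_leP/injfunPex.
  have /choice[f fP] : forall a, exists b, A a -> G (a, b).
    move=> a; have [/GA[b Gab]|nAa] := pselect (A a); first by exists b.
    by exists point.
  exists f => [a /fP/GAB[]//|a a' /set_mem/fP Ga /set_mem/fP Ga' faa'].
  by apply/(Ginj _ _ Ga Ga').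
move=> /not_implyP[Aa nGa].
have [GB|/existsNP[b]] := pselect (forall b, B b -> exists a, G (a, b)).
  right; apply/pcard_leP/injfunPex.
  have /choice[f fP] : forall b, exists a, B b -> G (a, b).
    move=> b; have [/GB[c Gcb]|nBb] := pselect (B b); first by exists c.
    by exists point.
  exists f => [b /fP/GAB[]//|b b' /set_mem/fP Gb /set_mem/fP Gb' fbb'].
  by apply/(Ginj _ _ Gb Gb').
move=> /not_implyP[Bb nGb].
case: (Gmax (G `|` [set (a, b)])).
  split; first by move=> p Gp; left.
  by move=> /(_ (a, b) (or_intror erefl)) Gab; apply: nGa; exists b.
split=> [p [/GAB//|->//]|[x y] [x' y'] [Gp|[-> ->]] [Gq|[-> ->]]] //=.
- exact: (Ginj _ _ Gp Gq).
- by split=> e; [case: nGa; exists y; rewrite -e|case: nGb; exists x; rewrite -e].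
- by split=> e; [case: nGa; exists y'; rewrite e|case: nGb; exists x'; rewrite e].
Qed.

(** Points of [C] outside [D] are coded in [D] by [g]. Two booleans record which coordinates were
    coded, and [pickle] absorbs them into the [nat] factor. *)
Lemma card_leX_enlarge {U : pointedType} {C D : set U} :
    C `\` D #<= D -> [set: nat] `*` (D `*` D) #<= D ->
  [set: nat] `*` (C `*` C) #<= D.
Proof.
move=> /pcard_leP/injfunPex[g gfun ginj] /pcard_leP/injfunPex[f ffun finj].
apply/pcard_leP/injfunPex.
pose e x := if `[< D x >] then x else g x.
have eD x : C x -> D (e x).
  by rewrite /e; case: asboolP => // nDx Cx; exact: gfun.
have einj x y : C x -> C y -> `[< D x >] = `[< D y >] -> e x = e y -> x = y.
  rewrite /e => Cx Cy; case: asboolP; case: asboolP => // nDy nDx _.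
  by apply: ginj; exact/mem_set.
pose F (p : nat * (U * U)) := (pickle (p.1, `[< D p.2.1 >], `[< D p.2.2 >]), (e p.2.1, e p.2.2)).
have FD p : C p.2.1 -> C p.2.2 -> ([set: nat] `*` (D `*` D)) (F p).
  by move=> Cx Cy; do !split=> //; exact: eD.
exists (f \o F) => [p [_ [Cx Cy]]|]; first exact/ffun/FD.
move=> p q /set_mem[_ [px py]] /set_mem[_ [qx qy]].
move=> /(finj _ _ (mem_set (FD p px py)) (mem_set (FD q qx qy))).
move: p q px py qx qy => [n [x y]] [n' [x' y']] /= Cx Cy Cx' Cy'.
by move=> [/(pcan_inj pickleK)[-> Dx Dy] ex ey]; rewrite (einj x x') // (einj y y').
Qed.

(** Zorn's lemma is applied to graphs of injections from [nat * (D * D)] to [D] with [D] inside [A].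
    For a maximal one, [A] minus [D] embeds in [D], since otherwise [D] has a disjoint copy in [A]
    onto which the graph extends. *)
Lemma infinite_card_leX (U : pointedType) (A : set U) :
  infinite_set A -> [set: nat] `*` (A `*` A) #<= A.
Proof.
move=> /infiniteP/pcard_leP/injfunPex[h hfun hinj].
(* The square on which a graph [G] is defined is recovered from its diagonal,
   so that it grows with [G] along a chain. *)
pose dom (G : set ((nat * (U * U)) * U)) := [set x | exists y, G ((0, (x, x)), y)].
pose P : set (set ((nat * (U * U)) * U)) := [set G |
  [/\ dom G `<=` A,
     forall p, G p -> [/\ dom G p.1.2.1, dom G p.1.2.2 & dom G p.2],
     forall p, dom G p.2.1 -> dom G p.2.2 -> exists z, G (p, z) &
     forall p q, G p -> G q -> (p.1 = q.1 <-> p.2 = q.2)]].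
have domS G H : G `<=` H -> dom G `<=` dom H.
  by move=> GH x [y Gy]; exists y; exact: GH.
have [|G [[GA Gdom Gtot Ginj] Gmax]] := @Zorn_bigcup _ P.
  move=> F FP Ftot; split.
  - move=> x [y [G FG Gy]]; have [GA _ _ _] := FP _ FG.
    by apply: GA; exists y.
  - move=> p [G FG Gp]; have [_ /(_ _ Gp)[Gp1 Gp2 Gp3] _ _] := FP _ FG.
    have GF : G `<=` \bigcup_(X in F) X by exact: bigcup_sup.
    by split; exact: domS GF _ _.
  - move=> p [y [G FG Gy]] [z [H FH Hz]].
    have [GH|HG] := Ftot _ _ FG FH.
      have [_ _ Htot _] := FP _ FH.
      have [||w Hw] := Htot p; [by exists y; exact: GH|by exists z|].
      by exists w; exists H.
    have [_ _ Gtot _] := FP _ FG.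
    have [||w Gw] := Gtot p; [by exists y|by exists z; exact: HG|].
    by exists w; exists G.
  - move=> p q [G FG Gp] [H FH Hq].
    have [_ _ _ Ginj] := FP _ FG; have [_ _ _ Hinj] := FP _ FH.
    have [GH|HG] := Ftot _ _ FG FH.
      by apply: Hinj => //; exact: GH.
    by apply: Ginj => //; exact: HG.
set D := dom G in GA Gdom Gtot.
(* The empty graph satisfies [P], but it is not maximal: on the countable subset [h(nat)] of [A],
   [pickle] yields a larger graph. *)
have [D0|/set0P[d0 Dd0]] := eqVneq D set0.
  have G0 : G = set0.
    by apply/seteqP; split=> // p /Gdom[]; rewrite D0.
  pose H := [set ((p.1, (h p.2.1, h p.2.2)), h (pickle p)) | p in
    [set: nat * (nat * nat)]].
  have domH i : dom H (h i).
    by exists (h (pickle (0, (i, i)))), (0, (i, i)).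
  have domHE x : dom H x -> exists i, x = h i.
    by move=> [y [[n [i j]] _ [_ <- _ _]]]; exists i.
  have hI : injective h by move=> i j; apply: hinj; rewrite in_setT.
  case: (Gmax H).
    split; first by rewrite G0.
    move=> /(_ _ (imageP _ (I : [set: nat * (nat * nat)] (0, (0, 0))))).
    by rewrite G0.
  split.
  - by move=> x /domHE[i ->]; exact: hfun.
  - by move=> _ [[n [i j]] _ <-] /=; split; exact: domH.
  - move=> [n [x y]] /= /domHE[i ->] /domHE[j ->].
    by exists (h (pickle (n, (i, j)))), (n, (i, j)).
  - move=> _ _ [[n [i j]] _ <-] [[n' [i' j']] _ <-] /=; split.
      by move=> [-> /hI -> /hI ->].
    by move=> /hI/(pcan_inj pickleK)[-> -> ->].
have DD : [set: nat] `*` (D `*` D) #<= D.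
  have /choice[f fP] : forall p, exists z, D p.2.1 -> D p.2.2 -> G (p, z).
    move=> p; have [[Dx Dy]|nD] := pselect (D p.2.1 /\ D p.2.2).
      by have [z Gz] := Gtot _ Dx Dy; exists z.
    by exists point => Dx Dy; case: nD.
  apply/pcard_leP/injfunPex; exists f.
    by move=> p [_ [/= Dx Dy]]; have [] := Gdom _ (fP p Dx Dy).
  move=> p q /set_mem[_ [/= px py]] /set_mem[_ [/= qx qy]] fpq.
  by apply/(Ginj _ _ (fP p px py) (fP q qx qy)).
have [AD|] := card_le_total (A `\` D) D.
  exact: card_le_trans (card_leX_enlarge AD DD) (subset_card_le GA).
move=> /pcard_leP/injfunPex[g gfun ginj].
pose C := D `|` g @` D.
have /card_leX_enlarge/(_ DD)/pcard_leP/injfunPex[f ffun finj] : C `\` D #<= D.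
  apply: card_le_trans (card_image_le g D); apply: subset_card_le.
  by move=> x [[]].
(* [K] treats only the pairs new to the square and takes its values in [g(D)], disjoint from [D], so
   it clashes with [G] neither in arguments nor in values. *)
pose K : set ((nat * (U * U)) * U) := [set p |
  [/\ C p.1.2.1, C p.1.2.2, ~ (D p.1.2.1 /\ D p.1.2.2) & p.2 = g (f p.1)]].
have fD n x y : C x -> C y -> D (f (n, (x, y))) by move=> Cx Cy; exact: ffun.
have Cdom : dom (G `|` K) = C.
  apply/seteqP; split=> x; first by move=> [y [/Gdom[/= Dx _ _]|[]//]]; left.
  move=> Cx; have [[y Gy]|nDx] := pselect (D x); first by exists y; left.
  by exists (g (f (0, (x, x)))); right; split=> // -[].
have GK p q : G p -> K q -> p.1 = q.1 <-> p.2 = q.2.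
  move: p q => [[n [x y]] z] [[n' [x' y']] z'] /Gdom[/= Dx Dy Dz].
  move=> [/= Cx' Cy' nD ->]; split=> [[_ ex ey]|ez].
    by case: nD; rewrite -ex -ey.
  by case: (gfun _ (fD n' _ _ Cx' Cy')) => _; rewrite -ez.
case: (Gmax (G `|` K)).
  split; first by move=> p; left.
  move=> /(_ ((0, (g d0, g d0)), g (f (0, (g d0, g d0))))).
  have [_ nDg] := gfun _ Dd0.
  have Cg : C (g d0) by right; exists d0.
  by case/(_ (or_intror _)) /Gdom => //; split=> // -[].
split; rewrite ?Cdom.
- by move=> x [/GA//|[d /gfun[Agd _] <-]].
- move=> [[n [x y]] z] [/Gdom[/= Dx Dy Dz]|[/= Cx Cy _ ->]]; first by split; left.
  by split=> //; right; exists (f (n, (x, y))) => //; exact: fD.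
- move=> [n [x y]] /= Cx Cy; have [[Dx Dy]|nD] := pselect (D x /\ D y).
    by have [z Gz] := Gtot (n, (x, y)) Dx Dy; exists z; left.
  by exists (g (f (n, (x, y)))); right.
- move=> p q [Gp|Kp] [Gq|Kq]; [exact: Ginj|exact: GK| |].
    by have [pq qp] := GK _ _ Gq Kp; split=> /esym/[dup] => [/pq|/qp].
  move: p q Kp Kq => [[n [x y]] z] [[n' [x' y']] z'].
  move=> [/= Cx Cy _ ->] [/= Cx' Cy' _ ->]; split=> [->//|/ginj].
  rewrite !in_setE => /(_ (fD _ _ _ Cx Cy) (fD _ _ _ Cx' Cy')).
  by apply: finj; exact/mem_set.
Qed.

(** If [S] embeds in its complement, the complement is infinite and its square bound enlarges to all
    of [U]. Otherwise [S] is infinite and the same argument embeds [U] in [S], against [S #!=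
    [set: U]]. *)
Lemma card_leX_setC {U : pointedType} {S : set U} :
    infinite_set [set: U] -> S #!= [set: U] ->
  [set: nat * (U * U)] #<= ~` S.
Proof.
move=> Uinf /negP SU.
have finSC : finite_set S -> finite_set (~` S) -> False.
  by move=> Sfin SCfin; apply: Uinf; rewrite -(setUv S) finite_setU.
suff : [set: nat] `*` ([set: U] `*` [set: U]) #<= ~` S by rewrite !setXTT.
have [SC|CS] := card_le_total S (~` S).
  apply: card_leX_enlarge; first by rewrite setTD setCK.
  by apply: infinite_card_leX => SCfin; apply: finSC (card_le_finite SC _) _.
have Sinf : infinite_set S.
  by move=> Sfin; apply: finSC Sfin (card_le_finite CS Sfin).
case: SU; apply: Cantor_Bernstein; first exact: card_leT.
apply: (card_le_trans (B := [set: nat] `*` ([set: U] `*` [set: U]))); last first.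
  by apply: card_leX_enlarge (infinite_card_leX _ _ Sinf); rewrite setTD.
rewrite !setXTT; apply/pcard_leP/injfunPex.
by exists (fun u => (0, (u, u))) => // u v _ _ [].
Qed.

Theorem proposition20 (U : Type) (U_infinite : infinite_set [set: U]) :
  forall S : set U, card_lt S [set: U] ->
  exists star : U * U -> U,
    injective star /\ forall s : Sec, fix_sec star s #= S.
Proof.
elim/Ppointed: U U_infinite => U.
  by rewrite emptyE => /(_ (finite_set0 _)).
move=> Uinf S [_ SU].
have /pcard_leP/injfunPex[j jS jinj] := card_leX_setC Uinf SU.
have {}jinj : injective j by move=> p q; apply: jinj; rewrite in_setT.
have {}jS p : ~ S (j p) by exact: (jS p I).
(* The rank of [j (m, p)] is [m]; points outside the range of [j], among them those of [S], get
   0. *)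
have /choice[r rP] : forall u, exists n, forall m p, u = j (m, p) -> n = m.
  move=> u; have [[[m p] ->]|nu] := pselect (exists p, u = j p).
    by exists m => m' p' /jinj[].
  by exists 0 => m p up; case: nu; exists (m, p).
(* The successor makes the rank increase strictly; keeping [p] in the argument of [j] gives
   injectivity. *)
pose star p := if `[< S p.1 /\ p.1 = p.2 >] then p.1 else
  j ((r p.1 + r p.2).+1, p).
have starP u v : [/\ S u, u = v & star (u, v) = u] \/
    ~ S (star (u, v)) /\ (r u + r v < r (star (u, v)))%N.
  rewrite /star; case: asboolP => [[]|_]; first by left.
  by right; split=> //; rewrite (rP _ _ _ erefl).
exists star; split.
  move=> [x y] [x' y']; rewrite /star.
  case: asboolP => [[/= Sx <-]|_]; case: asboolP => [[/= Sx' <-]|_].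
  - by move=> ->.
  - by move=> xj; move: Sx; rewrite xj => /jS.
  - by move=> jx; move: Sx'; rewrite -jx => /jS.
  - by move=> /jinj[_ -> ->].
have symP c u v : rel_sym star c (u, v) ->
    u = v /\ S u \/ ~ S u /\ (r v < r u)%N.
  case: c; rewrite /= ?rel_piE ?rel_rhoE /= => -[x [y [-> ->]]].
    case: (starP x y) => [[Sx _ ->]|[nS lt]]; [by left|right; split=> //].
    exact: leq_ltn_trans (leq_addr _ _) lt.
  case: (starP x y) => [[Sx <- ->]|[nS lt]]; [by left|right; split=> //].
  exact: leq_ltn_trans (leq_addl _ _) lt.
(* The alternative is stated for all pairs because it survives composition; on the diagonal its
   second case is impossible. *)
have secP s : forall u v, rel_sec star s (u, v) ->
    u = v /\ S u \/ ~ S u /\ (r v < r u)%N.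
  elim: s => [c|c s IH] u v; first exact: symP.
  (* In mathcomp [r \; s] applies [s] first, so that [rel_sec] reads [s] from
     right to left; both readings range over the same relations. *)
  move=> [w /= /IH uw wv].
  have [[<- _]|[nSw ltvw]] := symP _ _ _ wv; first exact: uw.
  by right; case: uw => [[-> _]//|[nSu ltwu]]; split=> //; exact: ltn_trans ltwu.
have symS c u : S u -> rel_sym star c (u, u).
  move=> Su; have su : star (u, u) = u by rewrite /star asboolT.
  by case: c; rewrite /= ?rel_piE ?rel_rhoE /=; exists u, u; rewrite su.
move=> s; suff -> : fix_sec star s = S by exact: card_eqxx.
apply/seteqP; split=> u; rewrite /fix_sec /=.
  by move=> /secP[[]//|[_]]; rewrite ltnn.
by move=> Su; elim: s => [c|c s IH] /=; [exact: symS|exists u => //; exact: symS].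
Qed.
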